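(* Let $(\mathfrak m,\mathfrak g,\phi,\varphi,\sigma)$ be a crossed module of Lie $2$-algebras. Then the first cohomology group $\mathrm H^1(\mathfrak g,\mathfrak m)=\mathrm{Der}_0(\mathfrak g,\mathfrak m)/\mathrm{Inn}_0(\mathfrak g,\mathfrak m)$ is a quotient Lie algebra of $(\mathrm{Der}_0(\mathfrak g,\mathfrak m),\{\cdot,\cdot\})$.
   Context: All vector spaces are over a fixed ground field; $\wedge$ denotes skew-symmetry; $c.p.$ denotes the sum over the remaining cyclic permutations. Lie 2-algebras. A Lie 2-algebra $(\mathfrak g,d,l_2,l_3)$ is a 2-term complex $d:\mathfrak g_1\to\mathfrak g_0$ with a skew-symmetric bilinear bracket $l_2=[\cdot,\cdot]$ with components $\mathfrak g_0\times\mathfrak g_0\to\mathfrak g_0$ and $\mathfrak g_0\times\mathfrak g_1\to\mathfrak g_1$ ($[a,x]=-[x,a]$ and $[a,b]=0$ for $a,b\in\mathfrak g_1$), and a skew-symmetric trilinear $l_3:\wedge^3\mathfrak g_0\to\mathfrak g_1$, such that $d[x,a]=[x,da]$, $[da,b]=[a,db]$, $[[x,y],z]+c.p.=-dl_3(x,y,z)$, $[[x,y],a]+[[y,a],x]+[[a,x],y]=-l_3(x,y,da)$, and $\sum_{i=1}^4(-1)^{i+1}[x_i,l_3(x_1,..,\widehat{x_i},..,x_4)]+\sum_{i<j}(-1)^{i+j}l_3([x_i,x_j],x_1,..,\widehat{x_i},..,\widehat{x_j},..,x_4)=0$. It is strict if $l_3=0$. A Lie 2-algebra homomorphism $\psi=(\psi_0,\psi_1,\psi_2):\mathfrak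 g\to\mathfrak g'$ consists of linear maps $\psi_i:\mathfrak g_i\to\mathfrak g_i'$ ($i=0,1$) and $\psi_2:\wedge^2\mathfrak g_0\to\mathfrak g_1'$ with $d'\psi_1=\psi_0d$; $\psi_0[x,y]-[\psi_0x,\psi_0y]'=d'\psi_2(x,y)$; $\psi_1[x,a]-[\psi_0x,\psi_1a]'=\psi_2(x,da)$; $([\psi_0x,\psi_2(y,z)]'+c.p.)+l_3'(\psi_0x,\psi_0y,\psi_0z)=(\psi_2([x,y],z)+c.p.)+\psi_1l_3(x,y,z)$. Endomorphisms and derivations. For a 2-term complex $\mathbb V:V_1\xrightarrow{\partial}V_0$, $\mathrm{End}(\mathbb V)$ is the strict Lie 2-algebra with degree 0 part $\{(X_0,X_1):X_0\partial=\partial X_1\}$, degree 1 part $\mathrm{Hom}(V_0,V_1)$, differential $\delta(\Theta)=\partial\Theta+\Theta\partial$ and commutator brackets ($[X,\Theta]=X_1\Theta-\Theta X_0$). For a Lie 2-algebra $(\mathfrak m,\tilde d,\tilde l_2,\tilde l_3)$, $\mathrm{Der}(\mathfrak m)$ is the strict Lie 2-algebra with $\mathrm{Der}_1(\mathfrak m)=\mathrm{Hom}(\mathfrak m_0,\mathfrak m_1)$ and $\mathrm{Der}_0(\mathfrak m)$ the set of $X+l_X$, with $X=(X_0,X_1)$, $X_i\in\mathrm{End}(\mathfrak m_i)$, $l_X:\wedge^2\mathfrak m_0\to\mathfrak m_1$, satisfying $\tilde dX_1=X_0\tilde d$; $\tilde dl_X(\alpha,\beta)=X[\alpha,\beta]-[X\alpha,\beta]-[\alpha,X\beta]$;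 $l_X(\alpha,\tilde d\xi)=X[\alpha,\xi]-[X\alpha,\xi]-[\alpha,X\xi]$; $X\tilde l_3(\alpha,\beta,\gamma)=l_X(\alpha,[\beta,\gamma])+[\alpha,l_X(\beta,\gamma)]+\tilde l_3(X\alpha,\beta,\gamma)+c.p.(\alpha,\beta,\gamma)$. Its differential is $\Theta\mapsto\delta(\Theta)+l_{\delta(\Theta)}$ with $\delta(\Theta)=\tilde d\Theta+\Theta\tilde d$, $l_{\delta(\Theta)}(\alpha,\beta)=\Theta[\alpha,\beta]-[\alpha,\Theta\beta]-[\Theta\alpha,\beta]$; its brackets are $\{X+l_X,\Theta\}=[X,\Theta]$, $\{X+l_X,Y+l_Y\}=[X,Y]+X\triangleright l_Y-Y\triangleright l_X$, where $(X\triangleright l_Y)(\alpha,\beta)=Xl_Y(\alpha,\beta)-l_Y(X\alpha,\beta)-l_Y(\alpha,X\beta)$. Actions by derivations and crossed products. $\mathfrak g$ acts on $\mathfrak m$ by derivations if there are a Lie 2-algebra homomorphism $\phi=(\phi_0,\phi_1,\phi_2):\mathfrak g\to\mathrm{End}(\mathfrak m)$ and maps $l_{\phi_0(x)}:\wedge^2\mathfrak m_0\to\mathfrak m_1$ such that $\phi_0(x)+l_{\phi_0(x)}\in\mathrm{Der}_0(\mathfrak m)$ and $(\phi_0+l_{\phi_0},\phi_1,\phi_2):\mathfrak g\to\mathrm{Der}(\mathfrak m)$ is a Lie 2-algebra homomorphism. Write $x\triangleright\cdot=\phi_0(x)$, $a\triangleright\alpha=\phi_1(a)\alpha$, $(x,y)\triangleright\alpha=\phi_2(x,y)\alpha$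 ($x,y\in\mathfrak g_0,a\in\mathfrak g_1,\alpha\in\mathfrak m_0$). The crossed product $\mathfrak g\triangleright_\phi\mathfrak m$ is the Lie 2-algebra on $\mathfrak g\oplus\mathfrak m$ with differential $d+\tilde d$, bracket $[x+\alpha,y+\beta]=l_2(x,y)+\tilde l_2(\alpha,\beta)+x\triangleright\beta-y\triangleright\alpha$ and $L_3(x+\alpha,y+\beta,z+\gamma)=l_3(x,y,z)+\tilde l_3(\alpha,\beta,\gamma)-(x,y)\triangleright\gamma-(y,z)\triangleright\alpha-(z,x)\triangleright\beta+l_{\phi_0(x)}(\beta,\gamma)+l_{\phi_0(y)}(\gamma,\alpha)+l_{\phi_0(z)}(\alpha,\beta)$. Crossed modules. A crossed module of Lie 2-algebras consists of Lie 2-algebras $\mathfrak m=(\mathfrak m,\tilde d,\tilde l_2,\tilde l_3)$ and $\mathfrak g=(\mathfrak g,d,l_2,l_3)$, an action $\phi$ of $\mathfrak g$ on $\mathfrak m$ by derivations, and a Lie 2-algebra homomorphism $\Pi:\mathfrak g\triangleright_\phi\mathfrak m\to\mathfrak g$ with $\Pi|_{\mathfrak g}=(\mathrm{id},\mathrm{id},0)$, such that (i) $\tilde l_2(\alpha,\beta)=\Pi(\alpha)\triangleright\beta$ for $\alpha,\beta\in\mathfrak m$ (all degrees); (ii) $\tilde l_3(\alpha,\beta,\gamma)=-(\Pi_0\alpha,\Pi_0\beta)\triangleright\gamma-\Pi_2(\Pi_0\alpha,\beta)\triangleright\gamma$ for $\alpha,\beta,\gamma\in\mathfrak m_0$; (iii)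 $l_{\phi_0(x)}(\beta,\gamma)=-(x,\Pi_0\beta)\triangleright\gamma-\Pi_2(x,\beta)\triangleright\gamma$ for $x\in\mathfrak g_0$, $\beta,\gamma\in\mathfrak m_0$; (iv) $\Pi_2(\alpha,\beta)=\Pi_2(\Pi_0\alpha,\beta)=\Pi_2(\alpha,\Pi_0\beta)$ for $\alpha,\beta\in\mathfrak m_0$. It is denoted $(\mathfrak m,\mathfrak g,\phi,\varphi,\sigma)$ with $\varphi=(\varphi_0,\varphi_1,\varphi_2)=\Pi|_{\mathfrak m}$ and $\sigma=\Pi_2|_{\mathfrak g_0\wedge\mathfrak m_0}$ (so $\sigma(\alpha,x)=-\sigma(x,\alpha)$). Cocycles, coboundaries and bracket. $\mathrm{Der}_0(\mathfrak g,\mathfrak m)$ is the set of 1-cocycles of $\mathfrak g$ with values in $\mathfrak m$: elements $X+l_X$ with $X=(X_0,X_1)\in\mathrm{Hom}(\mathfrak g_0,\mathfrak m_0)\oplus\mathrm{Hom}(\mathfrak g_1,\mathfrak m_1)$, $l_X\in\mathrm{Hom}(\wedge^2\mathfrak g_0,\mathfrak m_1)$ satisfying, for $x,y,z\in\mathfrak g_0,a\in\mathfrak g_1$: $X_0d=\tilde dX_1$; $\tilde dl_X(x,y)=X[x,y]+y\triangleright Xx-x\triangleright Xy$; $l_X(x,da)=X[x,a]+a\triangleright Xx-x\triangleright Xa$; $Xl_3(x,y,z)=l_X(x,[y,z])+x\triangleright l_X(y,z)-(y,z)\triangleright Xx+c.p.(x,y,z)$. $\mathrm{Inn}_0(\mathfrak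 g,\mathfrak m)\subset\mathrm{Der}_0(\mathfrak g,\mathfrak m)$ is the set of 1-coboundaries: elements $X+l_X=\mathrm D(u+\Theta)$ with $u\in\mathfrak m_0$, $\Theta\in\mathrm{Hom}(\mathfrak g_0,\mathfrak m_1)$, i.e. $X_0x=x\triangleright u-\tilde d\Theta(x)$, $X_1a=a\triangleright u-\Theta(da)$, $l_X(x,y)=(x,y)\triangleright u+x\triangleright\Theta(y)-y\triangleright\Theta(x)-\Theta([x,y])$. The bracket on $\mathrm{Der}_0(\mathfrak g,\mathfrak m)$ is $$\{X+l_X,Y+l_Y\}=[X,Y]_\varphi+X\triangleright l_Y-Y\triangleright l_X+\omega^\sigma(X,Y),$$ where $[X,Y]_\varphi=X\circ\varphi\circ Y-Y\circ\varphi\circ X$ (componentwise), $(X\triangleright l_Y)(x,y)=X_1\varphi_1l_Y(x,y)-l_Y(\varphi_0X_0x,y)-l_Y(x,\varphi_0X_0y)$ and $\omega^\sigma(X,Y)(x,y)=X_1\sigma(Y_0x,y)+X_1\sigma(x,Y_0y)-Y_1\sigma(X_0x,y)-Y_1\sigma(x,X_0y)$; it makes $\mathrm{Der}_0(\mathfrak g,\mathfrak m)$ a Lie algebra. ''Quotient Lie algebra'' means that $\mathrm{Inn}_0(\mathfrak g,\mathfrak m)$ is an ideal. *)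

(* Defs.v *)
From HB Require Import structures.
From mathcomp Require Import all_boot all_algebra all_classical.
Set Implicit Arguments.
Unset Strict Implicit.
Unset Printing Implicit Defensive.
Import GRing.Theory.
Local Open Scope classical_set_scope.
Local Open Scope ring_scope.

(* Function spaces U -> V are lmodTypes for the pointwise operations, as set    *)
(* up in mathcomp.classical.functions.                                        *)

Section Multilinear.
Variables (k : fieldType) (U W V : lmodType k).

Definition bilinear_map (f : U -> W -> V) : Prop :=
  (forall w, linear (f^~ w)) /\ (forall u, linear (f u)).

(* Hom(wedge^2 U, V), where wedge means skew-symmetric, not alternating: the    *)
(* two differ in characteristic 2 only.                                       *)
Definition skew_bilinear (f : U -> U -> V) : Prop :=
  [/\ forall y, linear (f^~ y), forall x, linear (f x)
    & forall x y, f x y = - f y x].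

Definition skew_trilinear (f : U -> U -> U -> V) : Prop :=
  [/\ forall y z, linear (fun x => f x y z),
      forall x z, linear (fun y => f x y z),
      forall x y, linear (f x y),
      forall x y z, f x y z = - f y x z
    & forall x y z, f x y z = - f x z y].

Definition cyc (F : U -> U -> U -> V) (x y z : U) : V :=
  F x y z + F y z x + F z x y.

End Multilinear.

Record complex2 (k : fieldType) := Complex2 {
  deg0 : lmodType k;
  deg1 : lmodType k;
  diff : deg1 -> deg0 }.
Arguments Complex2 {k} deg0 deg1 diff.
Arguments deg0 {k} c.
Arguments deg1 {k} c.
Arguments diff {k} c a.

(* The operations of a Lie 2-algebra, without the axioms.  Only the components *)
(* g_0 x g_0 -> g_0 and g_0 x g_1 -> g_1 of l_2 are data: the component        *)
(* g_1 x g_0 -> g_1 is [br10] below, and l_2 vanishes on g_1 x g_1.            *)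
Record lie2_data (k : fieldType) := Lie2Data {
  cplx :> complex2 k;
  br00 : deg0 cplx -> deg0 cplx -> deg0 cplx;
  br01 : deg0 cplx -> deg1 cplx -> deg1 cplx;
  jac3 : deg0 cplx -> deg0 cplx -> deg0 cplx -> deg1 cplx }.
Arguments Lie2Data {k} cplx br00 br01 jac3.
Arguments br00 {k} l x y.
Arguments br01 {k} l x a.
Arguments jac3 {k} l x y z.

Definition br10 (k : fieldType) (L : lie2_data k) (a : deg1 L) (x : deg0 L) :
  deg1 L := - br01 L x a.

Record lie2_axioms (k : fieldType) (L : lie2_data k) : Prop := {
  lie2_diff_linear : linear (diff L);
  lie2_br00_skew : skew_bilinear (br00 L);
  lie2_br01_bilinear : bilinear_map (br01 L);
  lie2_jac3_skew : skew_trilinear (jac3 L);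
  lie2_diff_br : forall x a, diff L (br01 L x a) = br00 L x (diff L a);
  lie2_peiffer : forall a b, br01 L (diff L a) b = br10 a (diff L b);
  lie2_jacobi0 : forall x y z,
    cyc (fun x y z => br00 L (br00 L x y) z) x y z = - diff L (jac3 L x y z);
  lie2_jacobi1 : forall x y a,
    br01 L (br00 L x y) a + br10 (br01 L y a) x + br10 (br10 a x) y
    = - jac3 L x y (diff L a);
  lie2_coherence : forall x1 x2 x3 x4,
      br01 L x1 (jac3 L x2 x3 x4) - br01 L x2 (jac3 L x1 x3 x4)
    + br01 L x3 (jac3 L x1 x2 x4) - br01 L x4 (jac3 L x1 x2 x3)
    - jac3 L (br00 L x1 x2) x3 x4 + jac3 L (br00 L x1 x3) x2 x4
    - jac3 L (br00 L x1 x4) x2 x3 - jac3 L (br00 L x2 x3) x1 x4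
    + jac3 L (br00 L x2 x4) x1 x3 - jac3 L (br00 L x3 x4) x1 x2 = 0 }.

Record lie2_algebra (k : fieldType) := Lie2Algebra {
  lie2_ops :> lie2_data k;
  lie2_ax : lie2_axioms lie2_ops }.

Record is_lie2_hom (k : fieldType) (L L' : lie2_data k)
    (f0 : deg0 L -> deg0 L') (f1 : deg1 L -> deg1 L')
    (f2 : deg0 L -> deg0 L -> deg1 L') : Prop := {
  hom_linear0 : linear f0;
  hom_linear1 : linear f1;
  hom_skew2 : skew_bilinear f2;
  hom_diff : forall a, diff L' (f1 a) = f0 (diff L a);
  hom_br00 : forall x y,
    f0 (br00 L x y) - br00 L' (f0 x) (f0 y) = diff L' (f2 x y);
  hom_br01 : forall x a,
    f1 (br01 L x a) - br01 L' (f0 x) (f1 a) = f2 x (diff L a);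
  hom_jac3 : forall x y z,
    cyc (fun x y z => br01 L' (f0 x) (f2 y z)) x y z
      + jac3 L' (f0 x) (f0 y) (f0 z)
    = cyc (fun x y z => f2 (br00 L x y) z) x y z + f1 (jac3 L x y z) }.

(* End(V) and Der(m) are subspaces of spaces of functions.  [End_ops] and      *)
(* [Der_ops] carry their operations, extended by the same formulas to all      *)
(* functions; the subspaces themselves are [End0], [End1] and [Der0].          *)
Section EndDer.
Variable k : fieldType.

Section End.
Variable V : complex2 k.

Definition End0 : set ((deg0 V -> deg0 V) * (deg1 V -> deg1 V)) :=
  [set X | [/\ linear X.1, linear X.2
             & forall a, X.1 (diff V a) = diff V (X.2 a)]].

Definition End1 : set (deg0 V -> deg1 V) := [set Theta | linear Theta].

Definition End_delta (Theta : deg0 V -> deg1 V) :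
    (deg0 V -> deg0 V) * (deg1 V -> deg1 V) :=
  (fun v => diff V (Theta v), fun a => Theta (diff V a)).

Definition End_br00 (X Y : (deg0 V -> deg0 V) * (deg1 V -> deg1 V)) :
    (deg0 V -> deg0 V) * (deg1 V -> deg1 V) :=
  (fun v => X.1 (Y.1 v) - Y.1 (X.1 v), fun a => X.2 (Y.2 a) - Y.2 (X.2 a)).

Definition End_br01 (X : (deg0 V -> deg0 V) * (deg1 V -> deg1 V))
    (Theta : deg0 V -> deg1 V) : deg0 V -> deg1 V :=
  fun v => X.2 (Theta v) - Theta (X.1 v).

Definition End_ops : lie2_data k :=
  Lie2Data
    (Complex2 ((deg0 V -> deg0 V) * (deg1 V -> deg1 V))%type
              (deg0 V -> deg1 V) End_delta)
    End_br00 End_br01 (fun _ _ _ => 0).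

End End.

Section Der.
Variable m : lie2_data k.

Local Notation pre_der :=
  (((deg0 m -> deg0 m) * (deg1 m -> deg1 m)) *
   (deg0 m -> deg0 m -> deg1 m))%type.

(* An element X + l_X is the pair (X, l_X), with X = (X_0, X_1). *)
Definition Der0 : set pre_der :=
  [set D | let X0 := D.1.1 in let X1 := D.1.2 in let l := D.2 in
    [/\ [/\ linear X0, linear X1 & skew_bilinear l],
        forall xi, diff m (X1 xi) = X0 (diff m xi),
        forall al be, diff m (l al be) =
          X0 (br00 m al be) - br00 m (X0 al) be - br00 m al (X0 be),
        forall al xi, l al (diff m xi) =
          X1 (br01 m al xi) - br01 m (X0 al) xi - br01 m al (X1 xi)
      & forall al be ga, X1 (jac3 m al be ga) =
          cyc (fun al be ga => l al (br00 m be ga) + br01 m al (l be ga)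
                               + jac3 m (X0 al) be ga) al be ga]].

Definition Der_delta (Theta : deg0 m -> deg1 m) : pre_der :=
  (End_delta Theta,
   fun al be => Theta (br00 m al be) - br01 m al (Theta be)
                - br10 (Theta al) be).

Definition Der_act (X : (deg0 m -> deg0 m) * (deg1 m -> deg1 m))
    (l : deg0 m -> deg0 m -> deg1 m) : deg0 m -> deg0 m -> deg1 m :=
  fun al be => X.2 (l al be) - l (X.1 al) be - l al (X.1 be).

Definition Der_ops : lie2_data k :=
  Lie2Data
    (Complex2 pre_der (deg0 m -> deg1 m) Der_delta)
    (fun D E => (End_br00 D.1 E.1, Der_act D.1 E.2 - Der_act E.1 D.2))
    (fun D Theta => End_br01 D.1 Theta)
    (fun _ _ _ => 0).

End Der.

End EndDer.

Record action (k : fieldType) (g m : lie2_data k) := Action {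
  act0 : deg0 g -> (deg0 m -> deg0 m) * (deg1 m -> deg1 m);
  act1 : deg1 g -> deg0 m -> deg1 m;
  act2 : deg0 g -> deg0 g -> deg0 m -> deg1 m;
  actl : deg0 g -> deg0 m -> deg0 m -> deg1 m;
  act0_End : forall x, End0 (act0 x);
  act1_End : forall a, End1 (act1 a);
  act2_End : forall x y, End1 (act2 x y);
  act_hom_End : @is_lie2_hom k g (End_ops m) act0 act1 act2;
  act0_Der : forall x, @Der0 k m (act0 x, actl x);
  act_hom_Der :
    @is_lie2_hom k g (Der_ops m) (fun x => (act0 x, actl x)) act1 act2 }.

Section CrossedProduct.
Variables (k : fieldType) (g m : lie2_data k) (phi : action g m).

Definition crossed_product : lie2_data k :=
  Lie2Data
    (Complex2 (deg0 g * deg0 m)%type (deg1 g * deg1 m)%type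
       (fun a => (diff g a.1, diff m a.2)))
    (fun x y => (br00 g x.1 y.1,
       br00 m x.2 y.2 + (act0 phi x.1).1 y.2 - (act0 phi y.1).1 x.2))
    (fun x a => (br01 g x.1 a.1,
       br01 m x.2 a.2 + (act0 phi x.1).2 a.2 - act1 phi a.1 x.2))
    (fun x y z => (jac3 g x.1 y.1 z.1,
       jac3 m x.2 y.2 z.2
       - act2 phi x.1 y.1 z.2 - act2 phi y.1 z.1 x.2 - act2 phi z.1 x.1 y.2
       + actl phi x.1 y.2 z.2 + actl phi y.1 z.2 x.2 + actl phi z.1 x.2 y.2)).

End CrossedProduct.

Record crossed_module (k : fieldType) := CrossedModule {
  cm_m : lie2_algebra k;
  cm_g : lie2_algebra k;
  cm_phi : action cm_g cm_m;
  cm_Pi0 : deg0 cm_g * deg0 cm_m -> deg0 cm_g;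
  cm_Pi1 : deg1 cm_g * deg1 cm_m -> deg1 cm_g;
  cm_Pi2 : deg0 cm_g * deg0 cm_m -> deg0 cm_g * deg0 cm_m -> deg1 cm_g;
  cm_Pi_hom : @is_lie2_hom k (crossed_product cm_phi) cm_g cm_Pi0 cm_Pi1 cm_Pi2;
  cm_Pi0_g : forall x, cm_Pi0 (x, 0) = x;
  cm_Pi1_g : forall a, cm_Pi1 (a, 0) = a;
  cm_Pi2_g : forall x y, cm_Pi2 (x, 0) (y, 0) = 0;
  cm_peiffer00 : forall al be : deg0 cm_m,
    br00 cm_m al be = (act0 cm_phi (cm_Pi0 (0, al))).1 be;
  cm_peiffer01 : forall (al : deg0 cm_m) (xi : deg1 cm_m),
    br01 cm_m al xi = (act0 cm_phi (cm_Pi0 (0, al))).2 xi;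
  cm_peiffer10 : forall (xi : deg1 cm_m) (al : deg0 cm_m),
    br10 xi al = act1 cm_phi (cm_Pi1 (0, xi)) al;
  cm_jac3 : forall al be ga : deg0 cm_m,
    jac3 cm_m al be ga =
      - act2 cm_phi (cm_Pi0 (0, al)) (cm_Pi0 (0, be)) ga
      - act1 cm_phi (cm_Pi2 (cm_Pi0 (0, al), 0) (0, be)) ga;
  cm_actl : forall (x : deg0 cm_g) (be ga : deg0 cm_m),
    actl cm_phi x be ga =
      - act2 cm_phi x (cm_Pi0 (0, be)) ga
      - act1 cm_phi (cm_Pi2 (x, 0) (0, be)) ga;
  cm_Pi2_l : forall al be : deg0 cm_m,
    cm_Pi2 (0, al) (0, be) = cm_Pi2 (cm_Pi0 (0, al), 0) (0, be);
  cm_Pi2_r : forall al be : deg0 cm_m,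
    cm_Pi2 (0, al) (0, be) = cm_Pi2 (0, al) (cm_Pi0 (0, be), 0) }.

Section Cohomology.
Variables (k : fieldType) (C : crossed_module k).

Local Notation m := (cm_m C).
Local Notation g := (cm_g C).
Local Notation phi := (cm_phi C).

Definition varphi0 (al : deg0 m) : deg0 g := cm_Pi0 (0, al).
Definition varphi1 (xi : deg1 m) : deg1 g := cm_Pi1 (0, xi).
Definition sigma (x : deg0 g) (al : deg0 m) : deg1 g := cm_Pi2 (x, 0) (0, al).
(* sigma on m_0 x g_0 *)
Definition sigma' (al : deg0 m) (x : deg0 g) : deg1 g := - sigma x al.

Definition cochain : lmodType k :=
  (((deg0 g -> deg0 m) * (deg1 g -> deg1 m)) *
   (deg0 g -> deg0 g -> deg1 m))%type.

Definition part0 (X : cochain) : deg0 g -> deg0 m := X.1.1.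
Definition part1 (X : cochain) : deg1 g -> deg1 m := X.1.2.
Definition partl (X : cochain) : deg0 g -> deg0 g -> deg1 m := X.2.

Record is_cocycle (X : cochain) : Prop := {
  cocycle_linear0 : linear (part0 X);
  cocycle_linear1 : linear (part1 X);
  cocycle_skew : skew_bilinear (partl X);
  cocycle_diff : forall a, part0 X (diff g a) = diff m (part1 X a);
  cocycle_br00 : forall x y, diff m (partl X x y) =
    part0 X (br00 g x y) + (act0 phi y).1 (part0 X x)
    - (act0 phi x).1 (part0 X y);
  cocycle_br01 : forall x a, partl X x (diff g a) =
    part1 X (br01 g x a) + act1 phi a (part0 X x)
    - (act0 phi x).2 (part1 X a);
  cocycle_jac3 : forall x y z, part1 X (jac3 g x y z) =
    cyc (fun x y z => partl X x (br00 g y z) + (act0 phi x).2 (partl X y z)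
                      - act2 phi y z (part0 X x)) x y z }.

Definition Der0_gm : set cochain := [set X | is_cocycle X].

Definition coboundary (u : deg0 m) (Theta : deg0 g -> deg1 m) : cochain :=
  ((fun x => (act0 phi x).1 u - diff m (Theta x),
    fun a => act1 phi a u - Theta (diff g a)),
   fun x y => act2 phi x y u + (act0 phi x).2 (Theta y)
              - (act0 phi y).2 (Theta x) - Theta (br00 g x y)).

Definition Inn0_gm : set cochain :=
  [set X | exists u Theta, linear Theta /\ X = coboundary u Theta].

Definition cochain_act (X : cochain) (l : deg0 g -> deg0 g -> deg1 m) :
    deg0 g -> deg0 g -> deg1 m :=
  fun x y => part1 X (varphi1 (l x y)) - l (varphi0 (part0 X x)) y
             - l x (varphi0 (part0 X y)).

Definition omega (X Y : cochain) : deg0 g -> deg0 g -> deg1 m :=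
  fun x y => part1 X (sigma' (part0 Y x) y) + part1 X (sigma x (part0 Y y))
             - part1 Y (sigma' (part0 X x) y) - part1 Y (sigma x (part0 X y)).

Definition der_bracket (X Y : cochain) : cochain :=
  ((fun x => part0 X (varphi0 (part0 Y x)) - part0 Y (varphi0 (part0 X x)),
    fun a => part1 X (varphi1 (part1 Y a)) - part1 Y (varphi1 (part1 X a))),
   cochain_act X (partl Y) - cochain_act Y (partl X) + omega X Y).

End Cohomology.

(* Lie algebras whose underlying space is a subspace A of an ambient space V;   *)
(* br matters on A only.                                                      *)
Section LieAlgebra.
Variables (k : fieldType) (V : lmodType k) (br : V -> V -> V).

Definition subspace (A : set V) : Prop :=
  A 0 /\ forall (c : k) u v, A u -> A v -> A (c *: u + v).

Record is_lie_algebra (A : set V) : Prop := {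
  lie_subspace : subspace A;
  lie_closed : forall u v, A u -> A v -> A (br u v);
  lie_linear_l : forall (c : k) u v w, A u -> A v -> A w ->
    br (c *: u + v) w = c *: br u w + br v w;
  lie_linear_r : forall (c : k) u v w, A u -> A v -> A w ->
    br w (c *: u + v) = c *: br w u + br w v;
  lie_alternating : forall u, A u -> br u u = 0;
  lie_jacobi : forall u v w, A u -> A v -> A w ->
    br u (br v w) + br v (br w u) + br w (br u v) = 0 }.

Record is_lie_ideal (A I : set V) : Prop := {
  ideal_sub : I `<=` A;
  ideal_subspace : subspace I;
  ideal_br_l : forall u v, A u -> I v -> I (br u v);
  ideal_br_r : forall u v, I u -> A v -> I (br u v) }.

(* A / I is a quotient Lie algebra of (A, br) when I is an ideal of it.        *)
Definition quotient_lie_algebra (A I : set V) : Prop :=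
  is_lie_algebra A /\ is_lie_ideal A I.

End LieAlgebra.

(* Main.v *)
Require Import Defs.
From mathcomp Require Import all_boot all_algebra.
From mathcomp Require Import all_classical.
Set Implicit Arguments.
Unset Strict Implicit.
Unset Printing Implicit Defensive.
Import GRing.Theory.
Local Open Scope ring_scope.

(* For a cocycle X, composing with the crossed module gives a derivation        *)
(* hat X = (varphi_0 X_0, varphi_1 X_1, varphi_1 l_X + sigma(X_0 -, -)          *)
(* + sigma(-, X_0 -)) of g.  Writing X . F for the infinitesimal right action   *)
(* of a triple F on X, one has {X, Y} = X . hat Y - Y . hat X; moreover         *)
(* X . [F, G] = (X . F) . G - (X . G) . F and hat {X, Y} = [hat X, hat Y], the  *)
(* latter by condition (iv), and the Jacobi identity follows formally.  The     *)
(* failure of X . F to be a cocycle involves only the action of F on the values *)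
(* of X; for F = hat Y the Peiffer conditions (i)-(iii) make it symmetric in X  *)
(* and Y, so it cancels in the bracket.  Finally {X, D(u + Theta)} is the       *)
(* coboundary D(X_0 varphi_0 u + Theta') with                                   *)
(* Theta' = X_1 varphi_1 Theta - Theta varphi_0 X_0 - l_X(-, varphi_0 u)        *)
(*          - X_1 sigma(-, u).                                                  *)

(** Precomposition with triples on g, [precomp], is right-symmetric rather than associative: (X . F)
    . G - X . (F . G) is symmetric in F and G, so commutators of triples act as they should
    ([precomp_comm]). A cocycle X yields a derivation [hat X] of g ([hat_Der0]), the bracket is X .
    hat Y - Y . hat X ([der_bracketE]), and [hat] respects brackets ([hat_bracket]); the Jacobi
    identity is then a cancellation of iterated precompositions ([der_bracket_jacobi]).

    Closure is less formal. The three lemmas [precomp_cocycle_br00], [precomp_cocycle_br01] and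
    [precomp_cocycle_jac3] compute by how much X . F misses each cocycle equation, and
    [der_bracket_cocycle] shows that for F = hat Y these defects are symmetric in X and Y.

    For the ideal property, [der_bracket_coboundary] exhibits the bracket of a cocycle with a
    coboundary as a coboundary; antisymmetry gives the other side. *)

Inductive zexpr := ZAtom of nat | ZAdd of zexpr & zexpr | ZOpp of zexpr | ZZero.

Fixpoint zeval (V : zmodType) (env : seq V) (e : zexpr) : V :=
  match e with
  | ZAtom i => env`_i
  | ZAdd e1 e2 => zeval env e1 + zeval env e2
  | ZOpp e1 => - zeval env e1
  | ZZero => 0
  end.

Fixpoint zcoef (e : zexpr) (i : nat) : int :=
  match e with
  | ZAtom j => (i == j)%:Z
  | ZAdd e1 e2 => zcoef e1 i + zcoef e2 i
  | ZOpp e1 => - zcoef e1 i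
  | ZZero => 0
  end.

Lemma zeval_coef (V : zmodType) (env : seq V) (e : zexpr) :
  zeval env e = \sum_(i < size env) env`_i *~ zcoef e i.
Proof.
elim: e => [j|e1 IH1 e2 IH2|e1 IH1|] /=.
- case: (ltnP j (size env)) => hj.
    rewrite (bigD1 (Ordinal hj)) //= eqxx big1 ?addr0 // => i ne.
    by rewrite -val_eqE /= in ne; rewrite (negbTE ne) mulr0z.
  (* An index beyond the environment reads the default 0, and no summand on the right matches it. *)
  rewrite nth_default // big1 // => i _.
  by rewrite ltn_eqF ?mulr0z // (leq_trans (ltn_ord i)).
- by rewrite IH1 IH2 -big_split; apply: eq_bigr => i _; rewrite mulrzDr.
- by rewrite IH1 -sumrN; apply: eq_bigr => i _; rewrite mulrNz.
- by rewrite big1.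
Qed.

(** An abelian group expression is determined by the integer coefficients of its atoms; the
    hypothesis is a closed Boolean, settled by computation. *)
Lemma zeval_eq (V : zmodType) (env : seq V) (e1 e2 : zexpr) :
  all (fun i => zcoef e1 i == zcoef e2 i) (iota 0 (size env)) ->
  zeval env e1 = zeval env e2.
Proof.
move=> /allP h; rewrite !zeval_coef; apply: eq_bigr => i _.
by rewrite (eqP (h i _)) // mem_iota /= add0n.
Qed.

(* Atoms are compared up to conversion, because the implicit type arguments of
   equal terms may differ syntactically. *)
Ltac zindex x env :=
  lazymatch env with
  | nil => constr:(0%N)
  | ?y :: ?env' =>
    match constr:(Set) with
    | _ => let _ := match constr:(Set) with _ => unify x y end in
           constr:(0%N)
    | _ => let n := zindex x env' in constr:(S n)
    end
  end.

Ltac zinsert x env :=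
  lazymatch env with
  | nil => constr:(x :: nil)
  | ?y :: ?env' =>
    match constr:(Set) with
    | _ => let _ := match constr:(Set) with _ => unify x y end in
           constr:(env)
    | _ => let r := zinsert x env' in constr:(y :: r)
    end
  end.

Ltac zatoms t env :=
  lazymatch t with
  | @GRing.add _ ?a ?b => let env' := zatoms a env in zatoms b env'
  | @GRing.opp _ ?a => zatoms a env
  | @GRing.zero _ => constr:(env)
  | _ => zinsert t env
  end.

Ltac zreify t env :=
  lazymatch t with
  | @GRing.add _ ?a ?b =>
    let ea := zreify a env in let eb := zreify b env in constr:(ZAdd ea eb)
  | @GRing.opp _ ?a => let ea := zreify a env in constr:(ZOpp ea)
  | @GRing.zero _ => constr:(ZZero)
  | _ => let i := zindex t env in constr:(ZAtom i)
  end.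

(** Only sums, opposites and zero are interpreted. A scalar multiple is an atom, so scalars have to
    be distributed beforehand. *)
Ltac abel :=
  lazymatch goal with
  | |- @eq ?T ?a ?b =>
    let env0 := zatoms a (@nil T) in
    let env := zatoms b env0 in
    let ea := zreify a env in
    let eb := zreify b env in
    exact: (@zeval_eq _ env ea eb isT)
  end.


(** * Expansion rules for multilinear maps *)

Section LinearMaps.
Variable k : fieldType.

(** Moves terms across a known equation a = b: the second premise holds in the free abelian group
    and is left to [abel]. *)
Lemma eq_lincomb (V : zmodType) (a b l r : V) : a = b -> l + b = r + a -> l = r.
Proof. by move=> -> /addIr. Qed.

(** The rules form a tuple, so that one repeated rewrite expands a map completely. *)
Lemma linear_rules (U V : lmodType k) (f : U -> V) : linear f ->
  (forall x y, f (x + y) = f x + f y) * (forall x, f (- x) = - f x) * (f 0 = 0) *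
  (forall c x, f (c *: x) = c *: f x).
Proof.
move=> lf; have fD x y : f (x + y) = f x + f y.
  by have := lf 1 x y; rewrite !scale1r.
have f0 : f 0 = 0 by apply: (addrI (f 0)); rewrite -fD !addr0.
split=> [|c x].
  by split=> //; split=> // x; apply: (addrI (f x)); rewrite -fD !subrr.
by have := lf c x 0; rewrite f0 !addr0.
Qed.

Lemma bilinear_rules (U W V : lmodType k) (f : U -> W -> V) :
  (forall w, linear (f^~ w)) -> (forall u, linear (f u)) ->
  (forall x y z, f (x + y) z = f x z + f y z) *
  (forall x z, f (- x) z = - f x z) * (forall z, f 0 z = 0) *
  (forall c x z, f (c *: x) z = c *: f x z) *
  (forall x y z, f x (y + z) = f x y + f x z) *
  (forall x z, f x (- z) = - f x z) * (forall x, f x 0 = 0) *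
  (forall c x z, f x (c *: z) = c *: f x z).
Proof.
move=> hl hr; do !split; move=> *; first [
  by rewrite (linear_rules (hr _)) | by have /= -> := linear_rules (hl _) ].
Qed.

Lemma skew_bilinear_rules (U V : lmodType k) (f : U -> U -> V) :
  skew_bilinear f ->
  (forall x y z, f (x + y) z = f x z + f y z) *
  (forall x z, f (- x) z = - f x z) * (forall z, f 0 z = 0) *
  (forall c x z, f (c *: x) z = c *: f x z) *
  (forall x y z, f x (y + z) = f x y + f x z) *
  (forall x z, f x (- z) = - f x z) * (forall x, f x 0 = 0) *
  (forall c x z, f x (c *: z) = c *: f x z).
Proof. by case=> hl hr _; exact: bilinear_rules. Qed.

Lemma skew_trilinear_rules (U V : lmodType k) (f : U -> U -> U -> V) :
  skew_trilinear f ->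
  (forall x y z t, f (x + y) z t = f x z t + f y z t) *
  (forall x z t, f (- x) z t = - f x z t) * (forall z t, f 0 z t = 0) *
  (forall c x z t, f (c *: x) z t = c *: f x z t) *
  (forall x y z t, f x (y + z) t = f x y t + f x z t) *
  (forall x z t, f x (- z) t = - f x z t) * (forall x t, f x 0 t = 0) *
  (forall c x z t, f x (c *: z) t = c *: f x z t) *
  (forall x y z t, f x y (z + t) = f x y z + f x y t) *
  (forall x y z, f x y (- z) = - f x y z) * (forall x y, f x y 0 = 0) *
  (forall c x y z, f x y (c *: z) = c *: f x y z).
Proof.
case=> h1 h2 h3 _ _; do !split; move=> *; first [
    by rewrite (linear_rules (h3 _ _))
  | by have /= -> := linear_rules (h2 _ _)
  | by have /= -> := linear_rules (h1 _ _) ].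
Qed.

Lemma skew_bilinear_of_left (U V : lmodType k) (f : U -> U -> V) :
  (forall y, linear (f^~ y)) -> (forall x y, f x y = - f y x) ->
  skew_bilinear f.
Proof.
move=> lf sf; split=> // x c y z.
by rewrite sf (lf x c y z) opprD -scalerN -!sf.
Qed.

End LinearMaps.

(** * Multilinearity of the structure maps of the crossed module *)

Section CrossedModule.
Variables (k : fieldType) (C : crossed_module k).
Local Notation m := (lie2_ops (cm_m C)).
Local Notation g := (lie2_ops (cm_g C)).
Local Notation phi := (cm_phi C).
Local Notation "'A0' x" := (act0 phi x).1 (at level 9, x at level 8).
Local Notation "'A1' x" := (act0 phi x).2 (at level 9, x at level 8).
Local Notation A10 := (act1 phi).
Local Notation A2 := (act2 phi).
Local Notation Al := (actl phi).
Local Notation v0 := (@varphi0 k C).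
Local Notation v1 := (@varphi1 k C).
Local Notation si := (@sigma k C).


Lemma act0_rules :
  (forall x y z, A0 (x + y) z = A0 x z + A0 y z) *
  (forall x z, A0 (- x) z = - A0 x z) * (forall z, A0 0 z = 0) *
  (forall c x z, A0 (c *: x) z = c *: A0 x z) *
  (forall x y z, A0 x (y + z) = A0 x y + A0 x z) *
  (forall x z, A0 x (- z) = - A0 x z) * (forall x, A0 x 0 = 0) *
  (forall c x z, A0 x (c *: z) = c *: A0 x z).
Proof.
apply: (bilinear_rules (f := fun x v => A0 x v)) => [w c x y /=|x].
  by rewrite (hom_linear0 (act_hom_End phi)).
by case: (act0_End phi x).
Qed.

Lemma act0_rules1 :
  (forall x y z, A1 (x + y) z = A1 x z + A1 y z) *
  (forall x z, A1 (- x) z = - A1 x z) * (forall z, A1 0 z = 0) *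
  (forall c x z, A1 (c *: x) z = c *: A1 x z) *
  (forall x y z, A1 x (y + z) = A1 x y + A1 x z) *
  (forall x z, A1 x (- z) = - A1 x z) * (forall x, A1 x 0 = 0) *
  (forall c x z, A1 x (c *: z) = c *: A1 x z).
Proof.
apply: (bilinear_rules (f := fun x v => A1 x v)) => [w c x y /=|x].
  by rewrite (hom_linear0 (act_hom_End phi)).
by case: (act0_End phi x).
Qed.

Lemma act1_linear_l v : linear (fun a => A10 a v).
Proof. by move=> c x y /=; rewrite (hom_linear1 (act_hom_End phi)). Qed.

Lemma act2_skew v : skew_bilinear (fun x y => A2 x y v).
Proof.
have [h1 _ h3] := hom_skew2 (act_hom_End phi).
apply: skew_bilinear_of_left => [y c x x'|x y] /=; last by rewrite h3.
by have /= -> := h1 y c x x'.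
Qed.

Lemma act2_swap x y al : A2 x y al = - A2 y x al.
Proof. by case: (act2_skew al). Qed.

Lemma act2_rules :
  (forall x y z t, A2 (x + y) z t = A2 x z t + A2 y z t) *
  (forall x z t, A2 (- x) z t = - A2 x z t) * (forall z t, A2 0 z t = 0) *
  (forall c x z t, A2 (c *: x) z t = c *: A2 x z t) *
  (forall x y z t, A2 x (y + z) t = A2 x y t + A2 x z t) *
  (forall x z t, A2 x (- z) t = - A2 x z t) * (forall x t, A2 x 0 t = 0) *
  (forall c x z t, A2 x (c *: z) t = c *: A2 x z t) *
  (forall x y z t, A2 x y (z + t) = A2 x y z + A2 x y t) *
  (forall x y z, A2 x y (- z) = - A2 x y z) * (forall x y, A2 x y 0 = 0) *
  (forall c x y z, A2 x y (c *: z) = c *: A2 x y z).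
Proof.
have h v := skew_bilinear_rules (act2_skew v).
by do !split; move=> *; rewrite ?(linear_rules (act2_End _ _ _))//; rewrite (h _).
Qed.

Lemma actl_skew x : skew_bilinear (Al x).
Proof. by case: (act0_Der phi x) => -[_ _]. Qed.

Lemma varphi0_linear : linear v0.
Proof.
move=> c u v; rewrite /varphi0 -(hom_linear0 (cm_Pi_hom C)); congr (cm_Pi0 _).
by rewrite -[RHS]/(c *: 0 + 0, c *: u + v) scaler0 addr0.
Qed.

Lemma varphi1_linear : linear v1.
Proof.
move=> c u v; rewrite /varphi1 -(hom_linear1 (cm_Pi_hom C)); congr (cm_Pi1 _).
by rewrite -[RHS]/(c *: 0 + 0, c *: u + v) scaler0 addr0.
Qed.

Lemma sigma_linear_l w : linear (si^~ w).
Proof.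
move=> c u v; have [h _ _] := hom_skew2 (cm_Pi_hom C).
rewrite /sigma; have /= <- := h (0, w) c (u, 0) (v, 0); congr (cm_Pi2 _ _).
by rewrite -[RHS]/(c *: u + v, c *: 0 + 0) scaler0 addr0.
Qed.

Lemma sigma_linear_r w : linear (si w).
Proof.
move=> c u v; have [_ h _] := hom_skew2 (cm_Pi_hom C).
rewrite /sigma; have /= <- := h (w, 0) c (0, u) (0, v); congr (cm_Pi2 _ _).
by rewrite -[RHS]/(c *: 0 + 0, c *: u + v) scaler0 addr0.
Qed.

(** Brings every expression in the structure maps to a sum of monomials, the form that [abel] can
    compare. *)
Definition cm_rules :=
  (skew_bilinear_rules (lie2_br00_skew (lie2_ax (cm_g C))),
   skew_bilinear_rules (lie2_br00_skew (lie2_ax (cm_m C))),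
   bilinear_rules (lie2_br01_bilinear (lie2_ax (cm_g C))).1
     (lie2_br01_bilinear (lie2_ax (cm_g C))).2,
   bilinear_rules (lie2_br01_bilinear (lie2_ax (cm_m C))).1
     (lie2_br01_bilinear (lie2_ax (cm_m C))).2,
   skew_trilinear_rules (lie2_jac3_skew (lie2_ax (cm_g C))),
   skew_trilinear_rules (lie2_jac3_skew (lie2_ax (cm_m C))),
   linear_rules (lie2_diff_linear (lie2_ax (cm_g C))),
   linear_rules (lie2_diff_linear (lie2_ax (cm_m C))),
   act0_rules, act0_rules1,
   bilinear_rules act1_linear_l (act1_End phi), act2_rules,
   (fun x => skew_bilinear_rules (actl_skew x)),
   linear_rules varphi0_linear, linear_rules varphi1_linear,
   bilinear_rules sigma_linear_l sigma_linear_r).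

(** * The action as a homomorphism, evaluated on elements *)

Lemma act0_diff a al : A0 (diff g a) al = diff m (A10 a al).
Proof. by have /(congr1 (fun f => f.1 al)) /= := hom_diff (act_hom_End phi) a. Qed.

Lemma act0_diff1 a xi : A1 (diff g a) xi = A10 a (diff m xi).
Proof. by have /(congr1 (fun f => f.2 xi)) /= := hom_diff (act_hom_End phi) a. Qed.

Lemma act0_diff_comm x xi : A0 x (diff m xi) = diff m (A1 x xi).
Proof. by case: (act0_End phi x). Qed.

Lemma act0_br00 x y al :
  A0 (br00 g x y) al = A0 x (A0 y al) - A0 y (A0 x al) + diff m (A2 x y al).
Proof.
have h : A0 (br00 g x y) al - (A0 x (A0 y al) - A0 y (A0 x al))
    = diff m (A2 x y al).
  exact: (congr1 (fun f => f.1 al) (hom_br00 (act_hom_End phi) x y)).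
by apply: (eq_lincomb h); abel.
Qed.

Lemma act0_br00_1 x y xi :
  A1 (br00 g x y) xi = A1 x (A1 y xi) - A1 y (A1 x xi) + A2 x y (diff m xi).
Proof.
have h : A1 (br00 g x y) xi - (A1 x (A1 y xi) - A1 y (A1 x xi))
    = A2 x y (diff m xi).
  exact: (congr1 (fun f => f.2 xi) (hom_br00 (act_hom_End phi) x y)).
by apply: (eq_lincomb h); abel.
Qed.

Lemma act1_br01 x a al :
  A10 (br01 g x a) al = A1 x (A10 a al) - A10 a (A0 x al) + A2 x (diff g a) al.
Proof.
have h : A10 (br01 g x a) al - (A1 x (A10 a al) - A10 a (A0 x al))
    = A2 x (diff g a) al.
  exact: (congr1 (fun f => f al) (hom_br01 (act_hom_End phi) x a)).
by apply: (eq_lincomb h); abel.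
Qed.

Lemma act1_jac3 x y z al :
  A10 (jac3 g x y z) al =
  cyc (fun x y z => A1 x (A2 y z al) - A2 y z (A0 x al) - A2 (br00 g x y) z al)
    x y z.
Proof.
have h : cyc (fun x y z => A1 x (A2 y z al) - A2 y z (A0 x al)) x y z + 0
    = cyc (fun x y z => A2 (br00 g x y) z al) x y z + A10 (jac3 g x y z) al.
  exact: (congr1 (fun f => f al) (hom_jac3 (act_hom_End phi) x y z)).
by apply: (eq_lincomb (esym h)); rewrite /cyc; abel.
Qed.

(** * The homomorphism Pi on mixed arguments, and the Peiffer conditions *)

Lemma varphi_diff xi : diff g (v1 xi) = v0 (diff m xi).
Proof.
have := hom_diff (cm_Pi_hom C) (0, xi).
by rewrite /= !cm_rules.
Qed.

(** In the crossed product the bracket of (x, 0) and (0, be) is the action of x on be, so the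
    homomorphism law of Pi says that [sigma] measures the failure of [varphi0] to be equivariant. *)
Lemma varphi0_act x be :
  v0 (A0 x be) = br00 g x (v0 be) + diff g (si x be).
Proof.
have := hom_br00 (cm_Pi_hom C) (x, 0) (0, be).
rewrite /= !cm_rules !(add0r, addr0, subr0) cm_Pi0_g => h.
(* Restated up to conversion, to fold the values of Pi into [varphi0] and [sigma]. *)
have {}h : v0 (A0 x be) - br00 g x (v0 be) = diff g (si x be) by exact: h.
by apply: (eq_lincomb h); abel.
Qed.

Lemma varphi1_act x xi :
  v1 (A1 x xi) = br01 g x (v1 xi) + si x (diff m xi).
Proof.
have := hom_br01 (cm_Pi_hom C) (x, 0) (0, xi).
rewrite /= !cm_rules !(add0r, addr0, subr0) cm_Pi0_g => h.
have {}h : v1 (A1 x xi) - br01 g x (v1 xi) = si x (diff m xi) by exact: h.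
by apply: (eq_lincomb h); abel.
Qed.

Lemma Pi2_swap x al : cm_Pi2 (0, al) (x, 0) = - si x al.
Proof. by have [_ _ ->] := hom_skew2 (cm_Pi_hom C). Qed.

Lemma varphi1_act1 a al :
  v1 (A10 a al) = si (diff g a) al - br01 g (v0 al) a.
Proof.
have := hom_br01 (cm_Pi_hom C) (0, al) (a, 0).
rewrite /= !cm_rules !(add0r, addr0, subr0) cm_Pi1_g Pi2_swap => h.
have {}h : v1 (- A10 a al) - br01 g (v0 al) a = - si (diff g a) al by exact: h.
by apply: (eq_lincomb (esym h)); rewrite !cm_rules; abel.
Qed.

(** The coherence law of Pi at (x, 0), (y, 0), (0, ga), where the second component of L_3 is minus
    the action of (x, y) on ga. *)
Lemma varphi1_act2 x y ga :
  v1 (A2 x y ga) = si (br00 g x y) ga - si x (A0 y ga) + si y (A0 x ga)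
    - br01 g x (si y ga) + br01 g y (si x ga) - jac3 g x y (v0 ga).
Proof.
have := hom_jac3 (cm_Pi_hom C) (x, 0) (y, 0) (0, ga).
rewrite /cyc /= !cm_rules !(add0r, addr0, subr0) !cm_Pi0_g cm_Pi2_g !Pi2_swap => h.
have {}h : br01 g x (si y ga) + br01 g y (- si x ga) + br01 g (v0 ga) 0
    + jac3 g x y (v0 ga) =
  si (br00 g x y) ga - si x (A0 y ga) - si y (- A0 x ga) + v1 (- A2 x y ga).
  by exact: h.
by apply: (eq_lincomb h); rewrite !cm_rules; abel.
Qed.

(** Condition (iv) equates both sides with Pi_2(al, be), the right one after a swap of arguments. *)
Lemma sigma_varphi al be : si (v0 al) be = - si (v0 be) al.
Proof. by rewrite -Pi2_swap /sigma -cm_Pi2_r cm_Pi2_l. Qed.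

Lemma act0_varphi al be : A0 (v0 al) be = br00 m al be.
Proof. by rewrite cm_peiffer00. Qed.

Lemma act0_varphi1 al xi : A1 (v0 al) xi = br01 m al xi.
Proof. by rewrite cm_peiffer01. Qed.

Lemma act1_varphi xi al : A10 (v1 xi) al = - br01 m al xi.
Proof. by rewrite -cm_peiffer10. Qed.


Lemma act2_varphi_r x be ga : A2 x (v0 be) ga = - Al x be ga - A10 (si x be) ga.
Proof.
have h : Al x be ga = - A2 x (v0 be) ga - A10 (si x be) ga := cm_actl x be ga.
by apply: (eq_lincomb h); abel.
Qed.

Lemma act2_varphi_l x be ga : A2 (v0 be) x ga = Al x be ga + A10 (si x be) ga.
Proof.
by rewrite act2_swap act2_varphi_r; abel.
Qed.

Lemma br00_skew (L : lie2_algebra k) (x y : deg0 L) :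
  br00 L x y = - br00 L y x.
Proof. by case: (lie2_br00_skew (lie2_ax L)). Qed.

Lemma jac3_rot (L : lie2_algebra k) (x y z : deg0 L) :
  jac3 L x y z = jac3 L y z x.
Proof.
case: (lie2_jac3_skew (lie2_ax L)) => _ _ _ h1 h2.
by rewrite h1 h2 opprK.
Qed.

(** * Cochains on g and their infinitesimal precomposition *)

(** The target is arbitrary so that cochains in m and triples on g, such as [hat X], share one
    calculus. *)
Definition cochain_to (V0 V1 : lmodType k) : lmodType k :=
  (((deg0 g -> V0) * (deg1 g -> V1)) * (deg0 g -> deg0 g -> V1))%type.

(** The third component is the derivative at the identity of X_1 f_2 + l_X(f_0 -, f_0 -), the
    corresponding component of a composition of X with f. *)
Definition precomp (V0 V1 : lmodType k) (X : cochain_to V0 V1)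
    (F : cochain_to (deg0 g) (deg1 g)) : cochain_to V0 V1 :=
  ((X.1.1 \o F.1.1, X.1.2 \o F.1.2),
   fun x y => X.1.2 (F.2 x y) + X.2 (F.1.1 x) y + X.2 x (F.1.1 y)).

Lemma precompE (V0 V1 : lmodType k) (X : cochain_to V0 V1) F :
  (forall x, (precomp X F).1.1 x = X.1.1 (F.1.1 x)) *
  (forall a, (precomp X F).1.2 a = X.1.2 (F.1.2 a)).
Proof. by []. Qed.

Definition is_cochain (V0 V1 : lmodType k) (X : cochain_to V0 V1) : Prop :=
  [/\ linear X.1.1, linear X.1.2 & skew_bilinear X.2].

Lemma cochain_to_ext (V0 V1 : lmodType k) (X Y : cochain_to V0 V1) :
  X.1.1 =1 Y.1.1 -> X.1.2 =1 Y.1.2 -> X.2 =2 Y.2 -> X = Y.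
Proof.
case: X Y => -[X0 X1] Xl [[Y0 Y1] Yl] /= /funext -> /funext -> h.
by congr (_, _); apply/funext => x; apply/funext => y.
Qed.

Lemma precomp_cochain (V0 V1 : lmodType k) (X : cochain_to V0 V1) F :
  is_cochain X -> is_cochain F -> is_cochain (precomp X F).
Proof.
case: X F => -[X0 X1] Xl [[F0 F1] Fl] [/= l0 l1 s] [/= m0 m1 t].
have rX := (linear_rules l0, linear_rules l1, skew_bilinear_rules s).
have rF := (linear_rules m0, linear_rules m1, skew_bilinear_rules t).
split=> /= [c x y|c x y|]; rewrite /= ?(rX, rF)//.
have [_ _ s3] := s; have [_ _ t3] := t.
apply: skew_bilinear_of_left => [z c x y|x y] /=.
  by rewrite !(rX, rF) !scalerDr; abel.
by rewrite t3 !rX (s3 y) (s3 (F0 y)); abel.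
Qed.

(** The associator of X, F, G is l_X(F_0 x, G_0 y) + l_X(G_0 x, F_0 y) in the third component and
    zero in the others. Being symmetric in F and G, it drops out of the commutator. *)
Lemma precomp_comm (V0 V1 : lmodType k) (X : cochain_to V0 V1) F G :
  is_cochain X ->
  precomp X (precomp F G - precomp G F) =
  precomp (precomp X F) G - precomp (precomp X G) F.
Proof.
case: X F G => -[X0 X1] Xl [[F0 F1] Fl] [[G0 G1] Gl] [/= l0 l1 s].
have rX := (linear_rules l0, linear_rules l1, skew_bilinear_rules s).
apply: cochain_to_ext => [x|x|x y].
- by rewrite -[LHS]/(X0 (F0 (G0 x) - G0 (F0 x))) !rX.
- by rewrite -[LHS]/(X1 (F1 (G1 x) - G1 (F1 x))) !rX.
(* Both sides are spelled out by conversion, because the operations on pairs and functions hide the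
   pointwise terms. *)
have -> : (precomp (X0, X1, Xl) (precomp (F0, F1, Fl) (G0, G1, Gl)
    - precomp (G0, G1, Gl) (F0, F1, Fl))).2 x y =
  X1 (F1 (Gl x y) + Fl (G0 x) y + Fl x (G0 y)
      - (G1 (Fl x y) + Gl (F0 x) y + Gl x (F0 y)))
  + Xl (F0 (G0 x) - G0 (F0 x)) y + Xl x (F0 (G0 y) - G0 (F0 y)) by [].
have -> : (precomp (precomp (X0, X1, Xl) (F0, F1, Fl)) (G0, G1, Gl)
    - precomp (precomp (X0, X1, Xl) (G0, G1, Gl)) (F0, F1, Fl)).2 x y =
  X1 (F1 (Gl x y))
  + (X1 (Fl (G0 x) y) + Xl (F0 (G0 x)) y + Xl (G0 x) (F0 y))
  + (X1 (Fl x (G0 y)) + Xl (F0 x) (G0 y) + Xl x (F0 (G0 y)))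
  - (X1 (G1 (Fl x y))
  + (X1 (Gl (F0 x) y) + Xl (G0 (F0 x)) y + Xl (F0 x) (G0 y))
  + (X1 (Gl x (F0 y)) + Xl (G0 x) (F0 y) + Xl x (G0 (F0 y)))) by [].
by rewrite !rX; abel.
Qed.

(** * The derivation of g attached to a cocycle *)

(** The middle term is sigma(X_0 x, y), with its arguments swapped. *)
Definition hat (X : cochain C) : cochain_to (deg0 g) (deg1 g) :=
  ((v0 \o part0 X, v1 \o part1 X),
   fun x y => v1 (partl X x y) - si y (part0 X x) + si x (part0 X y)).

Lemma cocycle_cochain X : is_cocycle X -> is_cochain X.
Proof. by case. Qed.

(** The derivation equations are the images of the cocycle equations under varphi; the [sigma] terms
    of [hat] compensate for varphi not commuting with the action. *)
Lemma hat_Der0 X : is_cocycle X -> @Der0 k g (hat X).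
Proof.
case: X => -[X0 X1] Xl [l0 l1 sk hd hb h01 hj].
rewrite /part0 /part1 /partl /= in l0 l1 sk hd hb h01 hj.
have rX := (linear_rules l0, linear_rules l1, skew_bilinear_rules sk).
have [_ _ s3] := sk.
split; rewrite /= /part0 /part1 /partl /=.
- split.
  + by move=> c x y; rewrite /= l0 varphi0_linear.
  + by move=> c x y; rewrite /= l1 varphi1_linear.
  apply: skew_bilinear_of_left => [z c x y|x y] /=.
    by rewrite !(rX, cm_rules) !scalerDr scalerN; abel.
  by rewrite s3 !cm_rules; abel.
- by move=> xi; rewrite varphi_diff hd.
- move=> x y.
  have e a b : diff g (si a b) = v0 (A0 a b) - br00 g a (v0 b).
    by rewrite varphi0_act; abel.
  rewrite !cm_rules varphi_diff hb !e !cm_rules.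
  by rewrite (br00_skew (v0 _) y); abel.
- move=> x a; rewrite h01 hd !cm_rules varphi1_act varphi1_act1; abel.
move=> x y z; rewrite hj /cyc !(rX, cm_rules) !varphi1_act !varphi1_act2 !hb.
by rewrite !cm_rules !(jac3_rot (v0 _)); abel.
Qed.

(** * Closure of cocycles under the bracket *)

(** The Leibniz rule carries F through the brackets of g. The final summand collects the terms in
    which F falls on an argument acting on m; likewise in the next two lemmas. *)
Lemma precomp_cocycle_br00 X F x y : is_cocycle X -> @Der0 k g F ->
  diff m ((precomp X F).2 x y) =
    (precomp X F).1.1 (br00 g x y) + A0 y ((precomp X F).1.1 x)
    - A0 x ((precomp X F).1.1 y)
    + (A0 (F.1.1 y) (X.1.1 x) - A0 (F.1.1 x) (X.1.1 y)).
Proof.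
case: X F => -[X0 X1] Xl [[F0 F1] Fl] [l0 l1 sk hd hb h01 hj] [_ fd fb f01 fj].
rewrite /part0 /part1 /partl /= in l0 l1 sk hd hb h01 hj fd fb f01 fj *.
have rX := (linear_rules l0, linear_rules l1, skew_bilinear_rules sk).
by rewrite !cm_rules -hd fb !hb !(rX, cm_rules); abel.
Qed.

Lemma precomp_cocycle_br01 X F x a : is_cocycle X -> @Der0 k g F ->
  (precomp X F).2 x (diff g a) =
    (precomp X F).1.2 (br01 g x a) + A10 a ((precomp X F).1.1 x)
    - A1 x ((precomp X F).1.2 a)
    + (A10 (F.1.2 a) (X.1.1 x) - A1 (F.1.1 x) (X.1.2 a)).
Proof.
case: X F => -[X0 X1] Xl [[F0 F1] Fl] [l0 l1 sk hd hb h01 hj] [_ fd fb f01 fj].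
rewrite /part0 /part1 /partl /= in l0 l1 sk hd hb h01 hj fd fb f01 fj *.
have rX := (linear_rules l0, linear_rules l1, skew_bilinear_rules sk).
by rewrite f01 -fd !h01 !(rX, cm_rules); abel.
Qed.

Lemma precomp_cocycle_jac3 X F x y z : is_cocycle X -> @Der0 k g F ->
  (precomp X F).1.2 (jac3 g x y z) =
    cyc (fun x y z => (precomp X F).2 x (br00 g y z)
                      + A1 x ((precomp X F).2 y z)
                      - A2 y z ((precomp X F).1.1 x)) x y z
    + cyc (fun x y z => A1 (F.1.1 x) (X.2 y z) - A2 (F.1.1 y) z (X.1.1 x)
                        - A2 y (F.1.1 z) (X.1.1 x)
                        - A10 (F.2 y z) (X.1.1 x)) x y z.
Proof.
case: X F => -[X0 X1] Xl [[F0 F1] Fl] [l0 l1 sk hd hb h01 hj] [_ fd fb f01 fj].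
rewrite /part0 /part1 /partl /= in l0 l1 sk hd hb h01 hj fd fb f01 fj *.
have rX := (linear_rules l0, linear_rules l1, skew_bilinear_rules sk).
(* The derivation law of F on l_3 produces brackets of u in degree 0 with a = F_2(y, z); this
   expresses X_1 of them through d F_2, which the law on l_2 then evaluates. *)
have e u a : X1 (br01 g u a) = Xl u (diff g a) - A10 a (X0 u) + A1 u (X1 a).
  by rewrite h01; abel.
by rewrite fj /cyc !rX !e !hj /cyc !fb !(rX, cm_rules); abel.
Qed.

(** The summand [omega] consists of the terms that the [sigma] part of [hat] contributes. *)
Lemma der_bracketE X Y : is_cocycle X -> is_cocycle Y ->
  der_bracket X Y = precomp X (hat Y) - precomp Y (hat X).
Proof.
move=> cX cY; apply: cochain_to_ext => // x y.
have [l0 l1 sk] := cocycle_cochain cX; have [m0 m1 tk] := cocycle_cochain cY.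
case: X Y cX cY l0 l1 sk m0 m1 tk => -[X0 X1] Xl [[Y0 Y1] Yl] _ _ /=.
move=> l0 l1 sk m0 m1 tk.
have rX := (linear_rules l0, linear_rules l1, skew_bilinear_rules sk).
have rY := (linear_rules m0, linear_rules m1, skew_bilinear_rules tk).
set L := LHS; set R := RHS.
have -> : L = X1 (v1 (Yl x y)) - Yl (v0 (X0 x)) y - Yl x (v0 (X0 y))
  - (Y1 (v1 (Xl x y)) - Xl (v0 (Y0 x)) y - Xl x (v0 (Y0 y)))
  + (X1 (- si y (Y0 x)) + X1 (si x (Y0 y))
     - Y1 (- si y (X0 x)) - Y1 (si x (X0 y))) by [].
have -> : R = X1 (v1 (Yl x y) - si y (Y0 x) + si x (Y0 y))
  + Xl (v0 (Y0 x)) y + Xl x (v0 (Y0 y))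
  - (Y1 (v1 (Xl x y) - si y (X0 x) + si x (X0 y))
  + Yl (v0 (X0 x)) y + Yl x (v0 (X0 y))) by [].
by rewrite !(rX, rY); abel.
Qed.

Lemma is_cochain_lin (V0 V1 : lmodType k) c (X Y : cochain_to V0 V1) :
  is_cochain X -> is_cochain Y -> is_cochain (c *: X + Y).
Proof.
case: X Y => -[X0 X1] Xl [[Y0 Y1] Yl] [/= l0 l1 s] [/= m0 m1 t].
have rX := (linear_rules l0, linear_rules l1, skew_bilinear_rules s).
have rY := (linear_rules m0, linear_rules m1, skew_bilinear_rules t).
have [_ _ s3] := s; have [_ _ t3] := t.
split=> [b x y|b x y|] /=.
- rewrite -[LHS]/(c *: X0 (b *: x + y) + Y0 (b *: x + y)).
  rewrite -[RHS]/(b *: (c *: X0 x + Y0 x) + (c *: X0 y + Y0 y)).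
  by rewrite !(rX, rY) !scalerDr !scalerA mulrC; abel.
- rewrite -[LHS]/(c *: X1 (b *: x + y) + Y1 (b *: x + y)).
  rewrite -[RHS]/(b *: (c *: X1 x + Y1 x) + (c *: X1 y + Y1 y)).
  by rewrite !(rX, rY) !scalerDr !scalerA mulrC; abel.
apply: skew_bilinear_of_left => [z b x y|x y].
  rewrite -[LHS]/(c *: Xl (b *: x + y) z + Yl (b *: x + y) z).
  rewrite -[RHS]/(b *: (c *: Xl x z + Yl x z) + (c *: Xl y z + Yl y z)).
  by rewrite !(rX, rY) !scalerDr !scalerA mulrC; abel.
rewrite -[LHS]/(c *: Xl x y + Yl x y) -[RHS]/(- (c *: Xl y x + Yl y x)).
by rewrite s3 t3 scalerN; abel.
Qed.

Lemma cochain_subE (X Y : cochain C) :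
  (forall x, part0 (X - Y) x = X.1.1 x - Y.1.1 x) *
  (forall a, part1 (X - Y) a = X.1.2 a - Y.1.2 a) *
  (forall x y, partl (X - Y) x y = X.2 x y - Y.2 x y).
Proof. by []. Qed.

Lemma hatE (X : cochain C) :
  (forall x, (hat X).1.1 x = v0 (X.1.1 x)) *
  (forall a, (hat X).1.2 a = v1 (X.1.2 a)) *
  (forall x y, (hat X).2 x y
     = v1 (X.2 x y) - si y (X.1.1 x) + si x (X.1.1 y)).
Proof. by []. Qed.

Lemma actl_swap x be ga : Al x be ga = - Al x ga be.
Proof. by case: (actl_skew x). Qed.

Lemma der_bracket_cocycle (X Y : cochain C) :
  is_cocycle X -> is_cocycle Y -> is_cocycle (der_bracket X Y).
Proof.
move=> cX cY; rewrite der_bracketE //.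
have dX := hat_Der0 cX; have dY := hat_Der0 cY.
have [n0 n1 nk] : is_cochain (precomp X (hat Y) - precomp Y (hat X)).
  rewrite -scaleN1r addrC; apply: is_cochain_lin; apply: precomp_cochain;
    by [exact: cocycle_cochain | case: dX | case: dY].
split=> //.
- move=> a; rewrite !cochain_subE !precompE !hatE.
  have hX b : X.1.1 (diff g b) = diff m (X.1.2 b) := cocycle_diff cX b.
  have hY b : Y.1.1 (diff g b) = diff m (Y.1.2 b) := cocycle_diff cY b.
  by rewrite hX hY -!varphi_diff hX hY !cm_rules.
- move=> x y; move: (precomp_cocycle_br00 x y cX dY).
  move: (precomp_cocycle_br00 x y cY dX).
  (* With the two precompositions opaque, their own cocycle terms cancel as atoms and only the
     defects remain. *)
  move: (precomp X (hat Y)) (precomp Y (hat X)) => P Q hQ hP.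
  rewrite !cochain_subE !cm_rules hP hQ !hatE !act0_varphi.
  by rewrite (br00_skew (Y.1.1 x)) (br00_skew (Y.1.1 y)); abel.
- move=> x a; move: (precomp_cocycle_br01 x a cX dY).
  move: (precomp_cocycle_br01 x a cY dX).
  move: (precomp X (hat Y)) (precomp Y (hat X)) => P Q hQ hP.
  by rewrite !cochain_subE hP hQ !cm_rules !hatE !act0_varphi1 !act1_varphi; abel.
move=> x y z; move: (precomp_cocycle_jac3 x y z cX dY).
move: (precomp_cocycle_jac3 x y z cY dX).
move: (precomp X (hat Y)) (precomp Y (hat X)) => P Q hQ hP.
rewrite cochain_subE hP hQ /cyc !cochain_subE !hatE !cm_rules.
(* By condition (iii) the [sigma] terms cancel those from [hat]; the l_phi terms left over are
   symmetric in X and Y by skewness. *)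
rewrite !act0_varphi1 !act1_varphi !act2_varphi_r !act2_varphi_l.
by rewrite !(actl_swap _ (Y.1.1 _) (X.1.1 _)); abel.
Qed.

(** * Compatibility of [hat] with brackets, and the Jacobi identity *)

Lemma hat_bracket (X Y : cochain C) : is_cocycle X -> is_cocycle Y ->
  hat (der_bracket X Y) = precomp (hat X) (hat Y) - precomp (hat Y) (hat X).
Proof.
move=> cX cY; rewrite der_bracketE //.
apply: cochain_to_ext => [x|a|x y].
- rewrite -[LHS]/(v0 (X.1.1 (v0 (Y.1.1 x)) - Y.1.1 (v0 (X.1.1 x)))).
  by rewrite !cm_rules.
- rewrite -[LHS]/(v1 (X.1.2 (v1 (Y.1.2 a)) - Y.1.2 (v1 (X.1.2 a)))).
  by rewrite !cm_rules.
set R := RHS.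
have -> : R = v1 (X.1.2 ((hat Y).2 x y))
  + (v1 (X.2 (v0 (Y.1.1 x)) y) - si y (X.1.1 (v0 (Y.1.1 x)))
     + si (v0 (Y.1.1 x)) (X.1.1 y))
  + (v1 (X.2 x (v0 (Y.1.1 y))) - si (v0 (Y.1.1 y)) (X.1.1 x)
     + si x (X.1.1 (v0 (Y.1.1 y))))
  - (v1 (Y.1.2 ((hat X).2 x y))
  + (v1 (Y.2 (v0 (X.1.1 x)) y) - si y (Y.1.1 (v0 (X.1.1 x)))
     + si (v0 (X.1.1 x)) (Y.1.1 y))
  + (v1 (Y.2 x (v0 (X.1.1 y))) - si (v0 (X.1.1 y)) (Y.1.1 x)
     + si x (Y.1.1 (v0 (X.1.1 y))))) by [].
set L := LHS.
have -> : L = v1 (X.1.2 ((hat Y).2 x y) + X.2 (v0 (Y.1.1 x)) y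
    + X.2 x (v0 (Y.1.1 y))
    - (Y.1.2 ((hat X).2 x y) + Y.2 (v0 (X.1.1 x)) y + Y.2 x (v0 (X.1.1 y))))
  - si y (X.1.1 (v0 (Y.1.1 x)) - Y.1.1 (v0 (X.1.1 x)))
  + si x (X.1.1 (v0 (Y.1.1 y)) - Y.1.1 (v0 (X.1.1 y))) by [].
(* The surplus terms, of the form sigma(varphi_0 Y_0 x, X_0 y), cancel in pairs by condition
   (iv). *)
rewrite (sigma_varphi (Y.1.1 x)) (sigma_varphi (Y.1.1 y)) !cm_rules.
by abel.
Qed.

Lemma precomp_linear_l (V0 V1 : lmodType k) c (X Y : cochain_to V0 V1) F :
  precomp (c *: X + Y) F = c *: precomp X F + precomp Y F.
Proof.
apply: cochain_to_ext => // x y.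
rewrite -[LHS]/((c *: X.1.2 (F.2 x y) + Y.1.2 (F.2 x y))
  + (c *: X.2 (F.1.1 x) y + Y.2 (F.1.1 x) y)
  + (c *: X.2 x (F.1.1 y) + Y.2 x (F.1.1 y))).
rewrite -[RHS]/(c *: (X.1.2 (F.2 x y) + X.2 (F.1.1 x) y + X.2 x (F.1.1 y))
  + (Y.1.2 (F.2 x y) + Y.2 (F.1.1 x) y + Y.2 x (F.1.1 y))).
by rewrite !scalerDr; abel.
Qed.

Lemma precompBl (V0 V1 : lmodType k) (X Y : cochain_to V0 V1) F :
  precomp (X - Y) F = precomp X F - precomp Y F.
Proof. by rewrite -scaleN1r addrC precomp_linear_l scaleN1r addrC. Qed.

Lemma precomp_linear_r (V0 V1 : lmodType k) c (X : cochain_to V0 V1) F G :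
  is_cochain X -> precomp X (c *: F + G) = c *: precomp X F + precomp X G.
Proof.
case: X F G => -[X0 X1] Xl [[F0 F1] Fl] [[G0 G1] Gl] [/= l0 l1 s].
have rX := (linear_rules l0, linear_rules l1, skew_bilinear_rules s).
apply: cochain_to_ext => [x|a|x y].
- by rewrite -[LHS]/(X0 (c *: F0 x + G0 x)) !rX.
- by rewrite -[LHS]/(X1 (c *: F1 a + G1 a)) !rX.
set L := LHS; set R := RHS.
have -> : L = X1 (c *: Fl x y + Gl x y) + Xl (c *: F0 x + G0 x) y
  + Xl x (c *: F0 y + G0 y) by [].
have -> : R = c *: (X1 (Fl x y) + Xl (F0 x) y + Xl x (F0 y))
  + (X1 (Gl x y) + Xl (G0 x) y + Xl x (G0 y)) by [].
by rewrite !rX !scalerDr; abel.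
Qed.

Lemma hat_linear : linear hat.
Proof.
move=> c X Y; apply: cochain_to_ext => [x|a|x y].
- by rewrite -[LHS]/(v0 (c *: X.1.1 x + Y.1.1 x)) !cm_rules.
- by rewrite -[LHS]/(v1 (c *: X.1.2 a + Y.1.2 a)) !cm_rules.
set L := LHS; set R := RHS.
have -> : L = v1 (c *: X.2 x y + Y.2 x y) - si y (c *: X.1.1 x + Y.1.1 x)
  + si x (c *: X.1.1 y + Y.1.1 y) by [].
have -> : R = c *: (v1 (X.2 x y) - si y (X.1.1 x) + si x (X.1.1 y))
  + (v1 (Y.2 x y) - si y (Y.1.1 x) + si x (Y.1.1 y)) by [].
by rewrite !cm_rules !(scalerDr, scalerN); abel.
Qed.

(** Each {P, {Q, R}} expands into four iterated precompositions; in the cyclic sum every (A . B) . C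
    occurs once with each sign. *)
Lemma der_bracket_jacobi (X Y Z : cochain C) :
  is_cocycle X -> is_cocycle Y -> is_cocycle Z ->
  der_bracket X (der_bracket Y Z) + der_bracket Y (der_bracket Z X)
  + der_bracket Z (der_bracket X Y) = 0.
Proof.
have e (P Q R : cochain C) : is_cocycle P -> is_cocycle Q -> is_cocycle R ->
  der_bracket P (der_bracket Q R) =
    precomp (precomp P (hat Q)) (hat R) - precomp (precomp P (hat R)) (hat Q)
    - (precomp (precomp Q (hat R)) (hat P) - precomp (precomp R (hat Q)) (hat P)).
  move=> cP cQ cR; rewrite der_bracketE //; last exact: der_bracket_cocycle.
  rewrite hat_bracket // precomp_comm; last exact: cocycle_cochain.
  by rewrite der_bracketE // precompBl.
move=> cX cY cZ; rewrite !e //.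
by abel.
Qed.

Lemma der_bracketC (X Y : cochain C) : der_bracket X Y = - der_bracket Y X.
Proof.
apply: cochain_to_ext => [x|a|x y].
- by rewrite -[RHS]/(- (_ - _)) opprB.
- by rewrite -[RHS]/(- (_ - _)) opprB.
set L := LHS; set R := RHS.
have -> : L = cochain_act X (partl Y) x y - cochain_act Y (partl X) x y
  + (part1 X (sigma' (part0 Y x) y) + part1 X (sigma x (part0 Y y))
     - part1 Y (sigma' (part0 X x) y) - part1 Y (sigma x (part0 X y))) by [].
have -> : R = - (cochain_act Y (partl X) x y - cochain_act X (partl Y) x y
  + (part1 Y (sigma' (part0 X x) y) + part1 Y (sigma x (part0 X y))
     - part1 X (sigma' (part0 Y x) y) - part1 X (sigma x (part0 Y y)))) by [].
by abel.
Qed.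

(** * Coboundaries and their brackets with cocycles *)

(** The terms in u are the homomorphism equations of the action evaluated at u; those in Theta
    cancel by the same equations and the Jacobi identity of g up to d l_3. *)
Lemma coboundary_cocycle (u : deg0 m) (Th : deg0 g -> deg1 m) :
  linear Th -> is_cocycle (coboundary u Th : cochain C).
Proof.
move=> lTh; have rT := linear_rules lTh.
split; rewrite /part0 /part1 /partl /=.
- by move=> c x y /=; rewrite !(rT, cm_rules) scalerBr; abel.
- by move=> c x y /=; rewrite !(rT, cm_rules) scalerBr; abel.
- apply: skew_bilinear_of_left => [z c x y|x y] /=.
    by rewrite !(rT, cm_rules) !(scalerBr, scalerDr); abel.
  by rewrite (br00_skew x) (act2_swap x) rT; abel.
- by move=> a; rewrite act0_diff !cm_rules.
- by move=> x y; rewrite act0_br00 !cm_rules !act0_diff_comm; abel.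
- move=> x a; rewrite act1_br01 act0_diff1 (lie2_diff_br (lie2_ax (cm_g C))).
  by rewrite !cm_rules; abel.
move=> x y z.
have hd : diff g (jac3 g x y z) = - cyc (fun x y z => br00 g (br00 g x y) z) x y z.
  by rewrite (lie2_jacobi0 (lie2_ax (cm_g C))) opprK.
rewrite hd act1_jac3 /cyc !(rT, cm_rules) !act0_br00_1.
rewrite !(act2_swap (br00 _ _ _)) !(br00_skew (br00 _ _ _)) !(rT, cm_rules).
by abel.
Qed.

(** The data are read off in degree 0: equivariance of varphi_0 up to d sigma turns X_0 varphi_0(x
    acting on u) into X_0[x, varphi_0 u] + d X_1 sigma(x, u), and the cocycle equation turns
    X_0[x, varphi_0 u] into x acting on X_0 varphi_0 u, plus d l_X(x, varphi_0 u), minus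
    [u, X_0 x]. *)
Lemma der_bracket_coboundary (X : cochain C) (u : deg0 m)
    (Th : deg0 g -> deg1 m) :
  is_cocycle X -> linear Th ->
  der_bracket X (coboundary u Th) =
  coboundary (part0 X (v0 u))
    (fun x => part1 X (v1 (Th x)) - Th (v0 (part0 X x)) - partl X x (v0 u)
              - part1 X (si x u)).
Proof.
case: X => -[X0 X1] Xl [l0 l1 sk hd hb h01 hj] lTh.
rewrite /part0 /part1 /partl /= in l0 l1 sk hd hb h01 hj *.
have rX := (linear_rules l0, linear_rules l1, skew_bilinear_rules sk).
have rT := linear_rules lTh.
have [_ _ s3] := sk.
have e v a : X1 (br01 g v a) = Xl v (diff g a) - A10 a (X0 v) + A1 v (X1 a).
  by rewrite h01; abel.
apply: cochain_to_ext => [x|a|x y].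
- rewrite -[LHS]/(X0 (v0 (A0 x u - diff m (Th x)))
    - (A0 (v0 (X0 x)) u - diff m (Th (v0 (X0 x))))).
  rewrite -[RHS]/(A0 x (X0 (v0 u))
    - diff m (X1 (v1 (Th x)) - Th (v0 (X0 x)) - Xl x (v0 u) - X1 (si x u))).
  rewrite !cm_rules hb varphi0_act -!varphi_diff !rX -!hd varphi_diff !act0_varphi.
  by rewrite -varphi_diff (br00_skew u); abel.
- rewrite -[LHS]/(X1 (v1 (A10 a u - Th (diff g a)))
    - (A10 (v1 (X1 a)) u - Th (diff g (v1 (X1 a))))).
  rewrite -[RHS]/(A10 a (X0 (v0 u)) - (X1 (v1 (Th (diff g a)))
    - Th (v0 (X0 (diff g a))) - Xl (diff g a) (v0 u) - X1 (si (diff g a) u))).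
  rewrite !cm_rules varphi1_act1 !rX (s3 (diff g a)) e act1_varphi act0_varphi1.
  by rewrite varphi_diff hd; abel.
set L := LHS; set R := RHS.
have -> : L =
  X1 (v1 (A2 x y u + A1 x (Th y) - A1 y (Th x) - Th (br00 g x y)))
  - (A2 (v0 (X0 x)) y u + A1 (v0 (X0 x)) (Th y) - A1 y (Th (v0 (X0 x)))
     - Th (br00 g (v0 (X0 x)) y))
  - (A2 x (v0 (X0 y)) u + A1 x (Th (v0 (X0 y))) - A1 (v0 (X0 y)) (Th x)
     - Th (br00 g x (v0 (X0 y))))
  - (A10 (v1 (Xl x y)) u - Th (diff g (v1 (Xl x y)))
     - Xl (v0 (A0 x u - diff m (Th x))) y - Xl x (v0 (A0 y u - diff m (Th y))))
  + (X1 (- si y (A0 x u - diff m (Th x))) + X1 (si x (A0 y u - diff m (Th y)))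
     - (A10 (- si y (X0 x)) u - Th (diff g (- si y (X0 x))))
     - (A10 (si x (X0 y)) u - Th (diff g (si x (X0 y))))) by [].
have -> : R = A2 x y (X0 (v0 u))
  + A1 x (X1 (v1 (Th y)) - Th (v0 (X0 y)) - Xl y (v0 u) - X1 (si y u))
  - A1 y (X1 (v1 (Th x)) - Th (v0 (X0 x)) - Xl x (v0 u) - X1 (si x u))
  - (X1 (v1 (Th (br00 g x y))) - Th (v0 (X0 (br00 g x y)))
     - Xl (br00 g x y) (v0 u) - X1 (si (br00 g x y) u)) by [].
(* Here varphi_1 of the action of (x, y) on u yields l_3(x, y, varphi_0 u), whose image under X_1 is
   expanded by the last cocycle equation. *)
rewrite !cm_rules varphi1_act2 !varphi1_act !varphi0_act varphi_diff hb.
rewrite !cm_rules !varphi0_act !(rX, rT) !e hj /cyc !varphi_diff.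
rewrite !act0_varphi1 !act1_varphi !act2_varphi_r !act2_varphi_l.
rewrite (br00_skew (v0 (X0 x))) !(actl_swap _ u) !(br00_skew (v0 u)).
rewrite !(s3 (br00 g _ _)) !(s3 (v0 _)) !(s3 (diff g _)) !(rX, rT, cm_rules).
by abel.
Qed.

(** * Linear structure, and assembly of the Lie algebra and the ideal *)

Lemma cocycle_lin c (X Y : cochain C) :
  is_cocycle X -> is_cocycle Y -> is_cocycle (c *: X + Y).
Proof.
move=> cX cY.
have [n0 n1 nl] := is_cochain_lin c (cocycle_cochain cX) (cocycle_cochain cY).
have E0 x : part0 (c *: X + Y) x = c *: part0 X x + part0 Y x by [].
have E1 a : part1 (c *: X + Y) a = c *: part1 X a + part1 Y a by [].
have El x y : partl (c *: X + Y) x y = c *: partl X x y + partl Y x y by [].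
split=> // [a|x y|x a|x y z]; rewrite ?E0 ?E1 ?El ?/cyc ?E0 ?E1 ?El.
- by rewrite (cocycle_diff cX) (cocycle_diff cY) !cm_rules.
- rewrite !cm_rules (cocycle_br00 cX) (cocycle_br00 cY).
  by rewrite !(scalerDr, scalerN); abel.
- rewrite !cm_rules (cocycle_br01 cX) (cocycle_br01 cY).
  by rewrite !(scalerDr, scalerN); abel.
rewrite !cm_rules (cocycle_jac3 cX) (cocycle_jac3 cY) /cyc.
by rewrite !(scalerDr, scalerN); abel.
Qed.

Lemma coboundary0 : coboundary 0 (fun=> 0) = 0 :> cochain C.
Proof.
apply: cochain_to_ext => [x|a|x y] /=; rewrite !cm_rules ?subrr//.
by rewrite addr0 !subr0.
Qed.

Lemma coboundary_lin c u u' (Th Th' : deg0 g -> deg1 m) :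
  c *: (coboundary u Th : cochain C) + coboundary u' Th' =
  coboundary (c *: u + u') (fun x => c *: Th x + Th' x).
Proof.
apply: cochain_to_ext => [x|a|x y]; apply/esym.
- rewrite -[RHS]/(c *: (A0 x u - diff m (Th x)) + (A0 x u' - diff m (Th' x))) /=.
  by rewrite !cm_rules scalerBr; abel.
- rewrite -[RHS]/(c *: (A10 a u - Th (diff g a)) + (A10 a u' - Th' (diff g a))) /=.
  by rewrite !cm_rules scalerBr; abel.
rewrite -[RHS]/(c *: (A2 x y u + A1 x (Th y) - A1 y (Th x) - Th (br00 g x y))
  + (A2 x y u' + A1 x (Th' y) - A1 y (Th' x) - Th' (br00 g x y))) /=.
by rewrite !cm_rules !(scalerDr, scalerN); abel.
Qed.

Lemma der_bracket_linear_l c (X Y Z : cochain C) :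
  is_cocycle X -> is_cocycle Y -> is_cocycle Z ->
  der_bracket (c *: X + Y) Z = c *: der_bracket X Z + der_bracket Y Z.
Proof.
move=> cX cY cZ; have cXY := cocycle_lin c cX cY.
rewrite !der_bracketE // precomp_linear_l hat_linear.
by rewrite (precomp_linear_r _ _ _ (cocycle_cochain cZ)) scalerBr; abel.
Qed.

Lemma der_bracket_Inn_r (X Y : cochain C) :
  is_cocycle X -> Inn0_gm Y -> Inn0_gm (der_bracket X Y).
Proof.
move=> cX [u [Th [lTh ->]]]; rewrite der_bracket_coboundary //.
eexists; eexists; split; last reflexivity.
have [l0 l1 sk] := cocycle_cochain cX.
have rX := (linear_rules l0, linear_rules l1, skew_bilinear_rules sk).
move=> c x y; rewrite /part0 /part1 /partl.
by rewrite !(cm_rules, linear_rules lTh, rX) !(scalerDr, scalerN); abel.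
Qed.

Lemma Der0_gm_lie_algebra : is_lie_algebra (@der_bracket k C) (@Der0_gm k C).
Proof.
split.
- split; last by move=> c X Y; exact: cocycle_lin.
  rewrite -coboundary0; apply: coboundary_cocycle => c x y.
  by rewrite scaler0 addr0.
- exact: der_bracket_cocycle.
- by move=> c X Y Z; exact: der_bracket_linear_l.
- move=> c X Y Z cX cY cZ; rewrite der_bracketC der_bracket_linear_l //.
  by rewrite (der_bracketC Z X) (der_bracketC Z Y) scalerN opprD.
(* Antisymmetry alone would not suffice in characteristic 2; the difference form of the bracket
   vanishes outright. *)
- by move=> X cX; rewrite der_bracketE // subrr.
- exact: der_bracket_jacobi.
Qed.

Lemma Inn0_gm_lie_ideal :
  is_lie_ideal (@der_bracket k C) (@Der0_gm k C) (@Inn0_gm k C).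
Proof.
have InnB c (X Y : cochain C) :
    Inn0_gm X -> Inn0_gm Y -> Inn0_gm (c *: X + Y).
  move=> [u [Th [lTh ->]]] [u' [Th' [lTh' ->]]].
  exists (c *: u + u'), (fun x => c *: Th x + Th' x); split.
    move=> b x y; rewrite lTh lTh' !scalerDr !scalerA [b * c]mulrC; abel.
  exact: coboundary_lin.
have Inn_0 : Inn0_gm (0 : cochain C).
  exists 0, (fun=> 0); rewrite coboundary0; split=> // c x y.
  by rewrite scaler0 addr0.
split=> //.
- by move=> _ [u [Th [lTh ->]]]; exact: coboundary_cocycle.
- by move=> X Y; exact: der_bracket_Inn_r.
(* The opposite is written as -1 times the bracket plus 0, the shape of a linear combination. *)
- move=> X Y iX cY; rewrite der_bracketC -scaleN1r -[_ *: _]addr0.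
  by apply: InnB => //; exact: der_bracket_Inn_r.
Qed.

End CrossedModule.

Theorem proposition4p5 (k : fieldType) (C : crossed_module k) :
  quotient_lie_algebra (@der_bracket k C) (@Der0_gm k C) (@Inn0_gm k C).
Proof. by split; [exact: Der0_gm_lie_algebra | exact: Inn0_gm_lie_ideal]. Qed.
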